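(* There exists a one-dimensional local SFT domain $R$ such that the polynomial ring $R[X]$ is not an SFT ring. More precisely, $R[X]$ has a prime ideal that is not an SFT ideal and that is an upper to zero.
   Context: All rings are commutative with identity. An ideal $I$ of a ring $R$ is of strong finite type (SFT) if there are a finitely generated ideal $B\subseteq I$ and an integer $N\geq 1$ such that $a^N\in B$ for every $a\in I$. A ring is an SFT ring if every ideal of it is SFT. ''Local'' means having a unique maximal ideal (no Noetherian hypothesis), and dimension means Krull dimension. For a domain $D$, an upper to zero in $D[X]$ is a nonzero prime ideal of $D[X]$ whose contraction to $D$ is $(0)$. *)

(* Defs.v *)
From mathcomp Require Import all_boot all_algebra.
From mathcomp Require Import classical_sets.

Set Implicit Arguments.
Unset Strict Implicit.
Unset Printing Implicit Defensive.

Import GRing.Theory.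
Local Open Scope ring_scope.
Local Open Scope classical_set_scope.

(* Ideals are arbitrary [Prop]-valued subsets, and the unit ideal counts as
   one; [idealr_closed] of ring_quotient instead requires boolean membership
   and properness. *)
Definition is_ideal (R : comNzRingType) (I : set R) : Prop :=
  [/\ I 0, (forall x y, I x -> I y -> I (x + y))
    & (forall a x, I x -> I (a * x))].

Definition prime_ideal (R : comNzRingType) (P : set R) : Prop :=
  [/\ is_ideal P, ~ P 1 & forall x y, P (x * y) -> P x \/ P y].

Definition maximal_ideal (R : comNzRingType) (M : set R) : Prop :=
  [/\ is_ideal M, ~ M 1
    & forall J : set R, is_ideal J -> M `<=` J -> J = M \/ J = setT].

Definition local_ring (R : comNzRingType) : Prop :=
  exists! M : set R, maximal_ideal M.

Definition prime_chain (R : comNzRingType) (n : nat)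
    (P : 'I_n.+1 -> set R) : Prop :=
  (forall i, prime_ideal (P i)) /\
  (forall i j : 'I_n.+1, (i < j)%N -> P i `<` P j).

(* [prime_chain] with index [n] is a chain of [n + 1] primes; Krull dimension
   counts the strict inclusions. *)
Definition krull_dim_eq (R : comNzRingType) (d : nat) : Prop :=
  (exists P : 'I_d.+1 -> set R, prime_chain P) /\
  (forall (n : nat) (P : 'I_n.+1 -> set R), prime_chain P -> (n <= d)%N).

Definition ideal_gen (R : comNzRingType) (A : set R) : set R :=
  smallest (@is_ideal R) A.

Definition fg_ideal (R : comNzRingType) (B : set R) : Prop :=
  exists s : seq R, B = ideal_gen [set` s].

Definition sft_ideal (R : comNzRingType) (I : set R) : Prop :=
  exists (B : set R) (N : nat),
    [/\ fg_ideal B, B `<=` I, (1 <= N)%N & forall a, I a -> B (a ^+ N)].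

Definition sft_ring (R : comNzRingType) : Prop :=
  forall I : set R, is_ideal I -> sft_ideal I.

Definition upper_to_zero (D : idomainType) (Q : set {poly D}) : Prop :=
  [/\ prime_ideal Q, Q <> [set 0] & polyC @^-1` Q = [set 0]].

(* Main.v *)
(* Filter the field F = rat(u) by weights: constants have weight 0, u has weight
   1, u ^ (gap m) has the much smaller weight [wt m] (the gaps grow much faster
   than the weights) and each inverse of a polynomial has some very large
   weight.  Let G t be the elements of weight at most t and let R be the ring of
   the power series in c over F whose coefficient of c ^ i lies in
   G ((i - 1) ^ 2).
   Quadratic weights leave room to invert a power series up to a power of c, so
   every nonzero x in R divides a power of c; moreover x ^ 2 is a multiple of c
   for x in the maximal ideal.  Hence R is local, one-dimensional and SFT.
   Let Q be the ideal of the polynomials vanishing at u.  For a finitely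
   generated B inside Q there is a k such that c ^ k (b / (X - u)) has
   coefficients in R for all b in B.  But q = c ^ (wt m + 1) (X ^ n - u ^ n) is
   in Q for n = gap m, whereas q ^ N / (X - u) involves powers of u whose
   exponent is far from the multiples of n, which have too large a weight. *)
From HB Require Import structures.
From mathcomp Require Import all_boot all_algebra.
From mathcomp Require Import boolp classical_sets zify ring.
Require Import Defs.

Set Implicit Arguments.
Unset Strict Implicit.
Unset Printing Implicit Defensive.

Import GRing.Theory.
Local Open Scope ring_scope.
Local Open Scope classical_set_scope.

(** * Formal power series and their inverses *)

Record powser (F : Type) := Powser { pcoef :> nat -> F }.

HB.instance Definition _ (F : Type) := gen_eqMixin (powser F).
HB.instance Definition _ (F : Type) := gen_choiceMixin (powser F).

Lemma powserP (F : Type) (f g : powser F) : f =1 g -> f = g.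
Proof. by case: f g => [f] [g] /funext /= ->. Qed.

Section PowerSeriesRing.
Variable F : comNzRingType.
Implicit Types f g h : powser F.

Definition ps_zero : powser F := Powser (fun=> 0).
Definition ps_opp f := Powser (fun i => - f i).
Definition ps_add f g := Powser (fun i => f i + g i).

Fact ps_addA : associative ps_add.
Proof. by move=> f g h; apply: powserP => i /=; rewrite addrA. Qed.
Fact ps_addC : commutative ps_add.
Proof. by move=> f g; apply: powserP => i /=; rewrite addrC. Qed.
Fact ps_add0 : left_id ps_zero ps_add.
Proof. by move=> f; apply: powserP => i /=; rewrite add0r. Qed.
Fact ps_addN : left_inverse ps_zero ps_opp ps_add.
Proof. by move=> f; apply: powserP => i /=; rewrite addNr. Qed.

HB.instance Definition _ :=
  GRing.isZmodule.Build (powser F) ps_addA ps_addC ps_add0 ps_addN.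

Definition ps_monom k (a : F) : powser F :=
  Powser (fun i => if i == k then a else 0).

Definition ps_mul f g :=
  Powser (fun n => \sum_(i < n.+1) f i * g (n - i)%N).

Definition ps_trunc m f : {poly F} := \poly_(i < m) f i.

(* Coefficients of a product only involve truncations, so that the ring axioms
   are inherited from {poly F}. *)
Lemma ps_mul_trunc m f g n : (n < m)%N ->
  ps_mul f g n = (ps_trunc m f * ps_trunc m g)`_n.
Proof.
move=> ltnm; rewrite coefM; apply: eq_bigr => i _ /=.
rewrite !coef_poly (leq_ltn_trans (leq_ord i)) //.
by rewrite (leq_ltn_trans (leq_subr _ _)).
Qed.

Fact ps_mulC : commutative ps_mul.
Proof.
by move=> f g; apply: powserP => n; rewrite !(@ps_mul_trunc n.+1) // mulrC.
Qed.

Fact ps_mulA : associative ps_mul.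
Proof.
have mul3 f g h n : ps_mul (ps_mul f g) h n =
    (ps_trunc n.+1 f * ps_trunc n.+1 g * ps_trunc n.+1 h)`_n.
  rewrite coefM; apply: eq_bigr => i _.
  rewrite (@ps_mul_trunc n.+1) ?ltn_ord // coef_poly.
  by rewrite (leq_ltn_trans (leq_subr _ _)).
move=> f g h; apply: powserP => n; rewrite mul3 ps_mulC mul3.
by rewrite mulrC mulrA.
Qed.

Fact ps_mul1 : left_id (ps_monom 0 1) ps_mul.
Proof.
move=> f; apply: powserP => n /=; rewrite big_ord_recl /= mul1r subn0.
by rewrite big1 ?addr0 // => i _; rewrite mul0r.
Qed.

Fact ps_mulDl : left_distributive ps_mul ps_add.
Proof.
move=> f g h; apply: powserP => n /=; rewrite -big_split /=.
by apply: eq_bigr => i _; rewrite mulrDl.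
Qed.

Fact ps_one_neq0 : ps_monom 0 1 != 0 :> powser F.
Proof.
by apply/eqP => /(congr1 (fun f : powser F => f 0%N)) /eqP; rewrite /= oner_eq0.
Qed.

HB.instance Definition _ := GRing.Zmodule_isComNzRing.Build (powser F)
  ps_mulA ps_mulC ps_mul1 ps_mulDl ps_one_neq0.

Lemma psN f i : (- f) i = - f i. Proof. by []. Qed.
Lemma psM f g n : (f * g) n = \sum_(i < n.+1) f i * g (n - i)%N.
Proof. by []. Qed.

Lemma psM_monom k a f n :
  (ps_monom k a * f) n = if (k <= n)%N then a * f (n - k)%N else 0.
Proof.
rewrite psM; case: leqP => [lekn|ltnk].
  rewrite (bigD1 (inord k)) //= inordK ?ltnS // eqxx big1 ?addr0 // => i.
  by rewrite -val_eqE /= inordK ?ltnS // => /negPf ->; rewrite mul0r.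
rewrite big1 // => i _ /=.
by rewrite ltn_eqF ?mul0r // (leq_ltn_trans (leq_ord i)).
Qed.

Lemma ps_monomM k a l b :
  ps_monom k a * ps_monom l b = ps_monom (k + l)%N (a * b).
Proof.
apply: powserP => n; rewrite psM_monom /=.
case: leqP => [lekn|ltnk].
  by rewrite -(eqn_add2l k) subnKC //; case: eqP => // _; rewrite mulr0.
by rewrite ltn_eqF // (leq_trans ltnk (leq_addr _ _)).
Qed.

Lemma ps_monomX k a n : ps_monom k a ^+ n = ps_monom (k * n)%N (a ^+ n).
Proof.
elim: n => [|n IHn]; first by rewrite muln0.
by rewrite !exprS IHn ps_monomM mulnS.
Qed.

Lemma ps_monomN k a : ps_monom k (- a) = - ps_monom k a.
Proof. by apply: powserP => n /=; case: eqP => //; rewrite oppr0. Qed.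

End PowerSeriesRing.

Section PowerSeriesField.
Variable F : fieldType.
Implicit Types f g h : powser F.

Lemma ps_neq0 f :
  f != 0 -> exists2 l, f l != 0 & forall i, (i < l)%N -> f i = 0.
Proof.
move=> f0; have [l fl]: exists l, f l != 0.
  apply: contrapT => /forallNP nf; case/eqP: f0; apply: powserP => i.
  by apply/eqP/negPn/negP => /nf.
have exl : exists l, f l != 0 by exists l.
exists (ex_minn exl); first by case: ex_minnP.
case: ex_minnP => m _ minm i ltim; apply/eqP/negPn/negP => /minm.
by rewrite leqNgt ltim.
Qed.

Lemma ps_mulf_eq0 f g : f * g = 0 -> (f == 0) || (g == 0).
Proof.
move=> fg0; apply/norP => -[/ps_neq0[k fk k_min] /ps_neq0[l gl l_min]].
move: fg0 => /(congr1 (fun h : powser F => h (k + l)%N)).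
rewrite psM (bigD1 (inord k)) //= inordK ?ltnS ?leq_addr // addKn big1.
  by move/eqP; rewrite addr0 mulf_eq0 (negPf fk) (negPf gl).
move=> i; rewrite -val_eqE /= inordK ?ltnS ?leq_addr //.
case: (ltngtP i k) => // [/k_min -> | ltki] _; first by rewrite mul0r.
by rewrite [g _]l_min ?mulr0 //; have := ltn_ord i; lia.
Qed.

(** The recursion is exported because the weight bounds on the inverse are proved by induction along
    it. *)
Lemma ps_inv_ex f : f 0%N != 0 -> exists2 z : powser F, f * z = 1 &
  z 0%N = (f 0%N)^-1 /\ forall j,
  z j.+1 = - (f 0%N)^-1 * \sum_(i < j.+1) f i.+1 * z (j - i)%N.
Proof.
move=> f0.
(* The recursion is course-of-values, so [tab n] stores the coefficients up to index [n]; its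
   entries beyond [n] are junk. *)
pose tab := fix tab n : nat -> F := if n is m.+1 then
    fun j => if (j <= m)%N then tab m j
             else - (f 0%N)^-1 * \sum_(i < m.+1) f i.+1 * tab m (m - i)%N
  else fun=> (f 0%N)^-1.
have tabE n j : (j <= n)%N -> tab n j = tab j j.
  elim: n => [|n IHn]; first by rewrite leqn0 => /eqP ->.
  rewrite leq_eqVlt => /predU1P[-> //|]; rewrite ltnS => lejn /=.
  by rewrite lejn IHn.
pose z := Powser (fun j => tab j j).
have zS j : z j.+1 = - (f 0%N)^-1 * \sum_(i < j.+1) f i.+1 * z (j - i)%N.
  rewrite /= ltnn; congr (_ * _); apply: eq_bigr => i _ /=.
  by rewrite tabE ?leq_subr.
exists z => //; apply: powserP => -[|j].
  by rewrite psM big_ord1 /= divff.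
rewrite psM big_ord_recl subn0 zS mulrA mulrN divff // mulN1r /=.
by rewrite addrC; apply/eqP; rewrite subr_eq0; apply/eqP.
Qed.

End PowerSeriesField.

(** * Filtered fields and the ring of filtered series *)

(** The cross term [b * (2 * i + 2)] of the expanded square absorbs [s + 2 * (i * l) + l ^ 2], the
    cost of a shift by [l] and of a factor of weight [s]. *)
Lemma shifted_weight s l a i (b := (s + l + l ^ 2)%N) :
  ((i + l) ^ 2 + (a + b) ^ 2 + s <= (a + i + 1 + b) ^ 2)%N.
Proof.
have bi : (s + 2 * (i * l) + l ^ 2 <= b * (2 * i + 2))%N by rewrite /b; nia.
have -> : ((a + i + 1 + b) ^ 2 =
  (a + b) ^ 2 + (i + 1) ^ 2 + a * (2 * i + 2) + b * (2 * i + 2))%N by lia.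
nia.
Qed.

(** [fil0V] makes [fil 0] a subfield; the constant terms of the series lie there, which will make
    the ring local. *)
Record filtration (F : fieldType) := Filtration {
  fil :> nat -> F -> Prop;
  fil1 : fil 0 1;
  filB : forall s x y, fil s x -> fil s y -> fil s (x - y);
  filM : forall s t x y, fil s x -> fil t y -> fil (s + t) (x * y);
  filS : forall s t x, (s <= t)%N -> fil s x -> fil t x;
  fil0V : forall x, fil 0 x -> fil 0 x^-1;
  fil_exhaustive : forall x, exists s, fil s x
}.

Section FilteredSeries.
Variables (F : fieldType) (G : filtration F).
Implicit Types f g : powser F.

Lemma fil0 s : G s 0.
Proof. by rewrite -(subrr 1); apply: filB; exact: filS (fil1 G). Qed.

Lemma filN s x : G s x -> G s (- x).
Proof. by move=> Gx; rewrite -sub0r; apply: filB => //; exact: fil0. Qed.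

Lemma filD s x y : G s x -> G s y -> G s (x + y).
Proof. by move=> Gx Gy; rewrite -[y]opprK; apply: filB => //; exact: filN. Qed.

Lemma fil_sum s n (h : 'I_n -> F) :
  (forall i, G s (h i)) -> G s (\sum_(i < n) h i).
Proof. by move=> Gh; elim/big_ind: _ => //; [exact: fil0 | exact: filD]. Qed.

(* The quadratic (superadditive and superlinear) weights make the inverse of a
   series with entries in the [G s] have entries growing no faster than the
   weights, up to a shift; they vanish at both 0 and 1. *)
Definition filps : {pred powser F} :=
  fun f => `[< forall i, G (i.-1 ^ 2)%N (f i) >].

Lemma filpsP f : reflect (forall i, G (i.-1 ^ 2)%N (f i)) (f \in filps).
Proof. exact: asboolP. Qed.

Fact filps_subring : subring_closed filps.
Proof.
split.
- apply/filpsP => -[|i]; first exact: fil1.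
  exact: fil0.
- by move=> f g /filpsP Gf /filpsP Gg; apply/filpsP => i; exact: filB.
move=> f g /filpsP Gf /filpsP Gg; apply/filpsP => n; apply: fil_sum => i.
apply: filS (filM (Gf i) (Gg (n - i)%N)); have := ltn_ord i; nia.
Qed.

Record fil_ring := FilRing { fil_val : powser F; _ : fil_val \in filps }.

HB.instance Definition _ := [isSub for fil_val].
HB.instance Definition _ := [Choice of fil_ring by <:].
HB.instance Definition _ :=
  GRing.SubChoice_isSubComNzRing.Build _ _ fil_ring filps_subring.

Definition fil_unit : {pred fil_ring} := fun x => `[< exists y, y * x = 1 >].

Definition fil_inv (x : fil_ring) : fil_ring :=
  if pselect (exists y, y * x = 1) is left e then projT1 (cid e) else x.

Fact fil_mulVr : {in fil_unit, left_inverse 1 fil_inv *%R}.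
Proof.
move=> x /asboolP ux; rewrite /fil_inv; case: pselect => // e.
by case: cid.
Qed.

Fact fil_unitPl (x y : fil_ring) : y * x = 1 -> fil_unit x.
Proof. by move=> yx; apply/asboolP; exists y. Qed.

Fact fil_inv_out : {in [predC fil_unit], fil_inv =1 id}.
Proof.
move=> x /negP nux; rewrite /fil_inv; case: pselect => // e.
by case: nux; apply/asboolP.
Qed.

HB.instance Definition _ := GRing.ComNzRing_hasMulInverse.Build fil_ring
  fil_mulVr fil_unitPl fil_inv_out.

Fact fil_mulf_eq0 : GRing.integral_domain_axiom fil_ring.
Proof.
move=> x y /(congr1 val); rewrite rmorphM rmorph0 => /ps_mulf_eq0.
by rewrite -!(rmorph0 (val : fil_ring -> _)) !val_eqE.
Qed.

HB.instance Definition _ := GRing.ComUnitRing_isIntegral.Build fil_ring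
  fil_mulf_eq0.

Lemma fil_ringE (x : fil_ring) i : G (i.-1 ^ 2)%N (val x i).
Proof. by case: x => f /= /filpsP. Qed.

Lemma ex_fil_ring f : (forall i, G (i.-1 ^ 2)%N (f i)) ->
  exists x : fil_ring, val x = f.
Proof. by move=> /filpsP Gf; exists (FilRing Gf). Qed.

Lemma ps_monom_fil k y : G (k.-1 ^ 2)%N y -> ps_monom k y \in filps.
Proof.
by move=> Gy; apply/filpsP => i /=; case: eqP => [->//|_]; exact: fil0.
Qed.

Definition fil_monom k y (Gy : G (k.-1 ^ 2)%N y) : fil_ring :=
  FilRing (ps_monom_fil Gy).

Fact fil_unif_subproof : G 0%N 1. Proof. exact: fil1. Qed.
Definition unif : fil_ring := @fil_monom 1 1 fil_unif_subproof.

Lemma unifX k : val (unif ^+ k) = ps_monom k 1.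
Proof. by rewrite rmorphXn /= ps_monomX mul1n expr1n. Qed.

Lemma unif_neq0 k : unif ^+ k != 0.
Proof.
apply/eqP => /(congr1 (fun x : fil_ring => val x k)) /eqP.
by rewrite unifX rmorph0 /= eqxx oner_eq0.
Qed.

Definition fil_max : set fil_ring := [set x : fil_ring | val x 0%N = 0].

Lemma fil_max_ideal : is_ideal fil_max.
Proof.
split=> [|x y|a x]; rewrite /fil_max /= ?rmorph0 ?rmorphD ?rmorphM //.
  by move=> -> ->; rewrite addr0.
by rewrite big_ord1 => ->; rewrite mulr0.
Qed.

(** The constant term is inverted within weight 0, so superadditivity of squares keeps the recursion
    for the inverse within the weights, without any shift. *)
Lemma fil_max_unit x : ~ fil_max x -> exists y, x * y = 1.
Proof.
move=> /eqP x0; have [z xz1 [z0 zS]] := ps_inv_ex x0.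
have Gx := fil_ringE x; have G0V := fil0V (Gx 0%N).
have Gz n : G (n.-1 ^ 2)%N (z n).
  elim/ltn_ind: n => -[|n] IHn; first by rewrite z0.
  rewrite zS /= mulNr; apply/filN; rewrite -[(n ^ 2)%N]add0n.
  apply: filM => //; apply: fil_sum => i.
  apply: filS (filM (Gx i.+1) (IHn (n - i)%N _)).
    by have := ltn_ord i; rewrite /=; nia.
  by have := ltn_ord i; lia.
have [y zy] := ex_fil_ring Gz; exists y; apply: val_inj.
by rewrite rmorphM /= zy xz1.
Qed.

Lemma dvd_unif_pow x : x != 0 -> exists k y, (0 < k)%N /\ x * y = unif ^+ k.
Proof.
move=> x0; have [|l xl l_min] := @ps_neq0 _ (val x).
  by rewrite -(rmorph0 (val : fil_ring -> _)) val_eqE.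
(* Both [v] and the inverse of its constant term may violate the weights of the ring; the shift [b]
   below pays for both. *)
pose v := Powser (fun i => val x (i + l)%N).
have xv : val x = ps_monom l 1 * v.
  apply: powserP => i; rewrite psM_monom mul1r.
  by case: leqP => [/subnK/= ->|/l_min].
have [|z vz1 [z0 zS]] := @ps_inv_ex _ v; first by [].
have [s Gs] := fil_exhaustive G (v 0%N)^-1.
pose b := (s + l + l ^ 2)%N.
have Gz n : G ((n + b) ^ 2)%N (z n).
  elim/ltn_ind: n => -[|n] IHn.
    by rewrite z0; apply: filS Gs; rewrite /b; nia.
  rewrite zS mulNr; apply/filN.
  have ltb : (s <= (n.+1 + b) ^ 2)%N by rewrite /b; nia.
  rewrite -(subnKC ltb); apply: filM => //; apply: fil_sum => i.
  apply: filS (filM (fil_ringE x (i.+1 + l)) (IHn (n - i)%N _)).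
    have := shifted_weight s l (n - i) i; rewrite subnK -1?ltnS // addn1 -/b.
    by rewrite addSn /=; lia.
  by have := ltn_ord i; lia.
(* Index [n + b.+1] allows exactly the weight [(n + b) ^ 2]. *)
have [|y yE] := @ex_fil_ring (ps_monom b.+1 1 * z).
  move=> i; rewrite psM_monom mul1r; case: leqP => [_|ltbi]; first exact: fil0.
  by apply: filS (Gz _); rewrite -{2}(subnK ltbi); nia.
exists (l + b.+1)%N, y; split; first by rewrite addnS.
apply: val_inj; rewrite unifX rmorphM /= yE [fil_val x]xv.
by rewrite mulrACA vz1 mulr1 ps_monomM mulr1.
Qed.

(** The end terms of the convolution vanish, and [(j - 1) ^ 2 + (i - j) ^ 2 <= (i - 1) ^ 2] for
    [1 <= j <= i], so the division by [unif] respects the weights. *)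
Lemma fil_max_sqr x : fil_max x -> exists y, x ^+ 2 = unif * y.
Proof.
rewrite /fil_max /= => x0; have [|y yE] :=
  @ex_fil_ring (Powser (fun i => val (x ^+ 2) i.+1)).
  move=> i; rewrite expr2 rmorphM; apply: fil_sum => -[j /= ltj].
  have [-> | j0] := posnP j; first by rewrite x0 mul0r; exact: fil0.
  have [-> | ji] := eqVneq j i.+1; first by rewrite subnn x0 mulr0; exact: fil0.
  apply: filS (filM (fil_ringE x j) (fil_ringE x (i.+1 - j))).
  by nia.
exists y; apply: val_inj; rewrite [RHS]rmorphM /= yE.
apply: powserP => -[|i]; rewrite psM_monom mul1r; last by rewrite subSS subn0.
by rewrite expr2 rmorphM psM big_ord1 x0 mul0r.
Qed.

(** A nonzero prime contains a power of [unif], hence [unif], hence the square of each element of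
    [fil_max]. *)
Lemma fil_prime_max (P : set fil_ring) : prime_ideal P -> P <> [set 0] ->
  P = fil_max.
Proof.
move=> [[P0 PD PM] P1 Pprime] Pn0.
have Pn0x : exists2 x, P x & x != 0.
  apply: contrapT => nP; apply: Pn0; apply/seteqP.
  split=> x //=; last by move=> ->.
  by move=> Px; apply: contrapT => /eqP x0; apply: nP; exists x.
have PX x n : P (x ^+ n) -> P x.
  elim: n => [/P1 //|n IHn]; rewrite exprS.
  by case/Pprime => // /IHn.
have Punif : P unif.
  have [x Px /dvd_unif_pow[k [y [_ xy]]]] := Pn0x.
  by apply: (@PX _ k); rewrite -xy mulrC; apply: PM.
apply/seteqP; split=> x.
  move=> Px; apply: contrapT => /fil_max_unit[y xy]; apply: P1.
  by rewrite -xy mulrC; exact: PM.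
by move=> /fil_max_sqr[y xy]; apply: (@PX _ 2); rewrite xy mulrC; exact: PM.
Qed.

Lemma fil_max_proper : ~ fil_max 1.
Proof. by move=> /eqP; rewrite oner_eq0. Qed.

Lemma fil_max_prime : prime_ideal fil_max.
Proof.
split; [exact: fil_max_ideal | exact: fil_max_proper |].
move=> x y; rewrite /fil_max /= big_ord1 => /eqP.
by rewrite mulf_eq0 => /orP[] /eqP; [left | right].
Qed.

Lemma fil_local : local_ring fil_ring.
Proof.
have ideal_sub (J : set fil_ring) : is_ideal J -> J `<=` fil_max \/ J = setT.
  move=> [_ _ JM]; have [|/existsNP[x /not_implyP[Jx /fil_max_unit[y xy]]]] :=
    pselect (J `<=` fil_max); first by left.
  right; apply/seteqP; split=> // z _.
  by rewrite -[z]mulr1 -xy [x * y]mulrC mulrA; exact: JM.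
exists fil_max; split.
  split; [exact: fil_max_ideal | exact: fil_max_proper |].
  move=> J /ideal_sub[JM MJ|]; [left|by right].
  by apply/seteqP; split.
move=> M [/[dup] Mi /ideal_sub[MM|->] M1 Mmax]; last by case: M1.
have [//|T] := Mmax _ fil_max_ideal MM.
by case: fil_max_proper; rewrite T.
Qed.

Lemma zero_prime (R : idomainType) : prime_ideal [set 0 : R].
Proof.
split=> [|/eqP|x y /= /eqP]; last 2 first.
- by rewrite oner_eq0.
- by rewrite mulf_eq0 => /orP[] /eqP; [left | right].
by split=> [//|x y /= -> ->|a x /= ->]; rewrite ?addr0 ?mulr0.
Qed.

Lemma fil_krull_dim : krull_dim_eq fil_ring 1.
Proof.
have unif_max : fil_max unif by [].
have max_n0 : fil_max <> [set 0].
  move=> M0; move: unif_max; rewrite M0 => /eqP.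
  by rewrite -[unif]expr1 (negPf (unif_neq0 1)).
split.
  exists (fun i => if i == ord0 then [set 0] else fil_max); split.
    by move=> i; case: ifP => _; [exact: zero_prime | exact: fil_max_prime].
  move=> i j ltij; have -> : i = ord0.
    by apply: val_inj; have /= := ltn_ord j; lia.
  rewrite eqxx ifF; last by apply/negP => /eqP j0; move: ltij; rewrite j0.
  split=> [x ->|sub]; first by have [] := fil_max_ideal.
  by apply: max_n0; apply/seteqP; split=> // x ->; have [] := fil_max_ideal.
move=> n P [Pprime Plt]; rewrite leqNgt; apply/negP => lt1n.
(* All terms after the first are nonzero primes, so the second and third cannot differ. *)
have PE (i : 'I_n.+1) : (0 < i)%N -> P i = fil_max.
  move=> i0; apply: fil_prime_max => // Pi0.
  have [_] := Plt ord0 i i0; apply; rewrite Pi0 => x ->.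
  by have [[]] := Pprime ord0.
have lt1 : (1 < n.+1)%N by lia.
have lt2 : (2 < n.+1)%N by lia.
have [_] := Plt (Ordinal lt1) (Ordinal lt2) isT.
by apply; rewrite !PE.
Qed.

End FilteredSeries.

(** * The SFT property of the filtered ring *)

Lemma ideal_gen_min (R : comNzRingType) (A J : set R) :
  is_ideal J -> A `<=` J -> ideal_gen A `<=` J.
Proof. by move=> Jid AJ x; apply. Qed.

(** Testing against every ideal [J] containing the generators avoids writing linear combinations. *)
Lemma sft_of_seq (R : comNzRingType) (I : set R) (s : seq R) N :
    is_ideal I -> [set` s] `<=` I -> (1 <= N)%N ->
    (forall a J, I a -> is_ideal J -> [set` s] `<=` J -> J (a ^+ N)) ->
  sft_ideal I.
Proof.
move=> Iid sI N1 sN; exists (ideal_gen [set` s]), N; split=> //.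
- by exists s.
- exact: ideal_gen_min.
- by move=> a Ia J [Jid sJ]; exact: sN.
Qed.

Section SFT.
Variables (F : fieldType) (G : filtration F).
Local Notation R := (fil_ring G).
Local Notation c := (unif G).

(** A nonzero ideal inside [fil_max] contains some [c ^+ k], and [a ^+ 2] in [(c)] puts
    [a ^+ (2 * k)] in [(c ^+ k)]. *)
Lemma fil_sft : sft_ring R.
Proof.
move=> I Iid; have [I0 ID IM] := Iid.
have [Imax|/existsNP[x /not_implyP[Ix /fil_max_unit[y xy]]]] :=
  pselect (I `<=` @fil_max F G); last first.
  apply: (@sft_of_seq _ _ [:: 1] 1) => //.
    by move=> z /=; rewrite inE => /eqP ->; rewrite -xy mulrC; exact: IM.
  move=> a J _ [_ _ JM] J1; rewrite expr1 -[a]mulr1; apply: JM.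
  by apply: J1; rewrite /= inE.
have [[x Ix x0]|nI] := pselect (exists2 x, I x & x != 0); last first.
  apply: (@sft_of_seq _ _ [::] 1) => // a J Ia [J0 _ _] _.
  suff -> : a = 0 by rewrite expr1.
  by apply: contrapT => /eqP a0; apply: nI; exists a.
have [k [y [k0 xy]]] := dvd_unif_pow x0.
apply: (@sft_of_seq _ _ [:: c ^+ k] (2 * k)) => //.
- by move=> z /=; rewrite inE => /eqP ->; rewrite -xy mulrC; exact: IM.
- by lia.
move=> a J /Imax/fil_max_sqr[z az] [_ _ JM] Jc.
rewrite exprM az exprMn mulrC; apply: JM.
by apply: Jc; rewrite /= inE.
Qed.

End SFT.

(** * The ideal of polynomials vanishing at [u] *)

Section UpperToZero.
Variables (F : fieldType) (G : filtration F) (u : F).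
Local Notation R := (fil_ring G).
Local Notation c := (unif G).
Definition ps_poly (p : {poly R}) : {poly powser F} := map_poly val p.
Local Notation U := (ps_monom 0 u).

Lemma ps_poly0 : ps_poly 0 = 0. Proof. exact: rmorph0. Qed.
Lemma ps_polyD : {morph ps_poly : p q / p + q}. Proof. exact: rmorphD. Qed.
Lemma ps_polyB : {morph ps_poly : p q / p - q}. Proof. exact: rmorphB. Qed.
Lemma ps_polyM : {morph ps_poly : p q / p * q}. Proof. exact: rmorphM. Qed.
Lemma ps_polyXn n : {morph ps_poly : p / p ^+ n}. Proof. exact: rmorphXn. Qed.
Lemma ps_polyX : ps_poly 'X = 'X. Proof. exact: map_polyX. Qed.
Lemma ps_polyC a : ps_poly a%:P = (val a)%:P. Proof. exact: map_polyC. Qed.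
Lemma ps_polyZ a p : ps_poly (a *: p) = ps_poly a%:P * ps_poly p.
Proof. by rewrite -mul_polyC ps_polyM. Qed.

Definition upper : set {poly R} := [set q | (ps_poly q).[U] = 0].

(** This is the kernel of an evaluation morphism into the domain [powser F]. *)
Lemma upper_prime : prime_ideal upper.
Proof.
split.
- split=> [|p q|a q]; rewrite /upper /mkset.
  + by rewrite ps_poly0 horner0.
  + by rewrite ps_polyD hornerD => -> ->; rewrite addr0.
  + by rewrite ps_polyM hornerM => ->; rewrite mulr0.
- rewrite /upper /mkset -[1]/(1%:P) ps_polyC rmorph1 hornerC => /eqP.
  by rewrite oner_eq0.
move=> p q; rewrite /upper /mkset ps_polyM hornerM => /ps_mulf_eq0.
by case/orP => /eqP; [left | right].
Qed.

(* The shift clears the denominator of [u], which need not lie in [R]. *)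
Lemma unif_clears : exists k (a : R), val a = ps_monom k u.
Proof.
have [s Gs] := fil_exhaustive G u.
have Gs' : G (s.+1.-1 ^ 2)%N u by apply: filS Gs; rewrite /=; nia.
by exists s.+1, (fil_monom Gs').
Qed.

Lemma upper_upper_to_zero : upper_to_zero upper.
Proof.
split; first exact: upper_prime.
  have [k [a aE]] := unif_clears.
  have : upper ((c ^+ k) *: 'X - a%:P).
    rewrite /upper /mkset ps_polyB ps_polyZ ps_polyX !ps_polyC.
    rewrite hornerD hornerN hornerM hornerX !hornerC.
    by rewrite aE unifX ps_monomM addn0 mul1r subrr.
  move=> + Q0; rewrite Q0 => /(congr1 (fun p : {poly R} => p`_1)) /eqP.
  by rewrite coefB coefZ coefX coefC coef0 subr0 mulr1 (negPf (unif_neq0 _ _)).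
apply/seteqP; split=> [a|a ->];
  rewrite /upper /mkset /preimage /mkset ps_polyC hornerC; last first.
  by rewrite rmorph0.
move=> a0; exact: val_inj.
Qed.

(* A fixed exponent [k] bounds the denominators of all quotients by ['X - u]
   of elements of a finitely generated ideal inside [upper]. *)
Definition bounded_quot k : set {poly R} :=
  [set q | exists r, ps_poly (c ^+ k *: q) = ('X - U%:P) * ps_poly r].

Lemma bounded_quot_ideal k : is_ideal (bounded_quot k).
Proof.
split=> [|p q [r pr] [s qs]|a q [r qr]].
- by exists 0; rewrite scaler0 ps_poly0 mulr0.
- by exists (r + s); rewrite scalerDr !ps_polyD pr qs mulrDr.
- by exists (a * r); rewrite scalerAr !ps_polyM qr mulrCA.
Qed.

Lemma bounded_quot_le k l : bounded_quot k `<=` bounded_quot (k + l).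
Proof.
move=> q [r qr]; exists (c ^+ l *: r); rewrite addnC exprD -scalerA.
by rewrite 2!(ps_polyZ (c ^+ l)) qr mulrCA.
Qed.

Lemma upper_bounded_quot q : upper q -> exists k, bounded_quot k q.
Proof.
have [v [a aE]] := unif_clears => Qq.
(* With a remainder [b] the claim holds for every [q] and allows induction; evaluation at [u] kills
   [b] when [q] is in [upper]. *)
suff [k [r [b E]]] : exists k r (b : R),
    ps_poly (c ^+ k *: q) = ('X - U%:P) * ps_poly r + ps_poly b%:P.
  exists k, r; rewrite E; have := congr1 (fun p => p.[U]) E.
  rewrite ps_polyZ hornerM [X in _ * X = _]Qq mulr0 hornerD hornerM.
  rewrite hornerD hornerN hornerX ps_polyC !hornerC subrr mul0r add0r => <-.
  by rewrite polyC0 addr0.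
elim/poly_ind: q {Qq} => [|q d [k [r [b E]]]].
  by exists 0%N, 0, 0; rewrite scaler0 polyC0 ps_poly0 mulr0 add0r.
(* One step of Horner division: the remainder gets multiplied by [u], and the factor [c ^+ v] brings
   this back into [R] as [a]. *)
exists (v + k)%N, (c ^+ v *: (r * 'X + b%:P)), (a * b + c ^+ (v + k) * d).
have cU : ps_poly a%:P = ps_poly (c ^+ v)%:P * U%:P.
  by rewrite !ps_polyC -polyCM aE unifX ps_monomM addn0 mul1r.
have step (A : comNzRingType) (X V cv ck p s e f : A) :
    ck * p = (X - V) * s + e -> cv * ck * (p * X + f) =
    (X - V) * (cv * (s * X + e)) + (cv * V * e + cv * ck * f).
  by move=> Ep; rewrite mulrDr mulrA -(mulrA cv) Ep; ring.
move: E; rewrite exprD.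
rewrite !(ps_polyZ, ps_polyD, ps_polyM, ps_polyX, polyCD, polyCM) cU.
exact: step.
Qed.

Lemma fg_bounded_quot (s : seq {poly R}) :
  [set` s] `<=` upper -> exists k, ideal_gen [set` s] `<=` bounded_quot k.
Proof.
move=> sQ; suff [k sk] : exists k, [set` s] `<=` bounded_quot k.
  by exists k; apply: ideal_gen_min => //; exact: bounded_quot_ideal.
elim: s sQ => [|q s IHs] sQ; first by exists 0%N => q.
have [|k sk] := IHs; first by move=> p ps; apply: sQ; rewrite /= inE ps orbT.
have [|l ql] := @upper_bounded_quot q; first by apply: sQ; rewrite /= inE eqxx.
exists (l + k)%N => p; rewrite /= inE => /predU1P[->|/sk].
  exact: bounded_quot_le.
by rewrite addnC; exact: bounded_quot_le.
Qed.

(** The binomial [c ^ w.+1 * (X ^ n - u ^ n)] lies in [upper], but the quotient of [c ^ k] times its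
    [N]-th power by [X - u] has, up to sign, a coefficient [u ^ e] too heavy for its index. *)
Lemma upper_not_sft : u != 0 ->
    (forall k N, (0 < N)%N -> exists w n e,
      [/\ G w (u ^+ n), (n * N.-1 <= e < n * N)%N &
          ~ G ((k + w.+1 * N).-1 ^ 2)%N (u ^+ e)]) ->
  ~ sft_ideal upper.
Proof.
move=> u0 gap [_ [N [[s ->] sQ N0 sN]]].
have [|k sk] := @fg_bounded_quot s.
  by apply: subset_trans sQ; exact: sub_gen_smallest.
have [w [n [e [Gun /andP[le_e lt_e]]]]] := gap k N N0; apply.
have wE : (w <= w.+1.-1 ^ 2)%N by rewrite /=; nia.
pose a : R := c ^+ w.+1.
pose b : R := fil_monom (filS wE Gun).
have qQ : upper (a *: 'X^n - b%:P).
  rewrite /upper /mkset ps_polyB ps_polyZ ps_polyXn ps_polyX !ps_polyC.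
  rewrite hornerD hornerN hornerM hornerXn !hornerC unifX ps_monomX ps_monomM.
  by rewrite mul0n addn0 mul1r subrr.
have /sk[r qr] := sN _ qQ.
(* Modulo ['X^n] the power is constant, which determines the coefficients of [r] below degree
   [n]. *)
have expr_low m : exists W : {poly R},
    (a *: 'X^n - b%:P) ^+ m = W * 'X^n + ((- b) ^+ m)%:P.
  elim: m => [|m [W IHm]]; first by exists 0; rewrite mul0r add0r.
  exists (a *: (W * 'X^n + ((- b) ^+ m)%:P) - b *: W).
  rewrite exprS IHm [(- b) ^+ m.+1]exprS polyCM polyCN -!mul_polyC.
  move: (_ ^+ m)%:P => bm; ring.
have [W qN] := expr_low N.
pose d := c ^+ k * (- b) ^+ N.
have dE : val d = ps_monom (k + w.+1 * N) ((- u ^+ n) ^+ N).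
  rewrite [LHS]rmorphM [X in X * _]unifX [X in _ * X]rmorphXn rmorphN /=.
  by rewrite -ps_monomN ps_monomX ps_monomM mul1r.
have n0 : (0 < n)%N.
  by rewrite lt0n; apply: contraTneq lt_e => ->; rewrite mul0n.
have coef_d i : (i < n)%N -> val (if i == 0 then d else 0) =
    (('X - U%:P) * ps_poly r)`_i.
  move=> ltin; rewrite -qr coef_map qN coefZ coefD coefMXn ltin add0r coefC.
  by case: ifP => _; rewrite ?mulr0.
(* Comparing coefficients gives [- U * r_0 = d] and [r_(i-1) = U * r_i]; the solution is stated
   without dividing by [U]. *)
have rE i : (i < n)%N -> U ^+ i.+1 * (ps_poly r)`_i = - val d.
  elim: i => [|i IHi] lti; have := coef_d _ lti.
    by rewrite mulrBl coefB coefXM coefCM sub0r /= => ->; rewrite opprK.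
  rewrite mulrBl coefB coefXM coefCM rmorph0 /= => /eqP.
  rewrite eq_sym subr_eq0 => /eqP iE.
  by rewrite exprSr -mulrA -iE IHi // ltnW.
(* At this degree the factor [U ^+ (n * N - e)] cancels against [u ^ (n * N)] and leaves
   [u ^+ e]. *)
have lt_i : (n * N - e.+1 < n)%N by move: le_e lt_e n0 N0; clear; case: N; nia.
have := rE _ lt_i; rewrite dE coef_map ps_monomX mul0n.
move/(congr1 (fun f : powser F => f (k + w.+1 * N)%N)).
rewrite psM_monom subn0 psN /= eqxx => vE.
have := fil_ringE r`_(n * N - e.+1) (k + w.+1 * N).
have -> : val r`_(n * N - e.+1) (k + w.+1 * N)%N =
    - ((-1) ^+ N * u ^+ e).
  apply: (mulfI (expf_neq0 (n * N - e.+1).+1 u0)); rewrite /= vE.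
  rewrite [(- u ^+ n) ^+ N]exprNn.
  rewrite -exprM mulrN [in RHS]mulrCA -exprD; congr (- (_ * u ^+ _)).
  lia.
move/filN; rewrite opprK -signr_odd; case: odd => //; rewrite ?mul1r //.
by rewrite expr1 mulN1r => /filN; rewrite opprK.
Qed.

End UpperToZero.

(** * The weight filtration on the rational functions *)

Local Open Scope quotient_scope.
Local Notation "x %:F" := (FracField.tofrac x).

Lemma tofrac_surj (D : idomainType) (x : {fraction D}) :
  exists a b : D, b != 0 /\ x = a%:F / b%:F.
Proof.
have [r ->] : exists r : {ratio D}, x = \pi_{fraction D} r.
  by exists (repr x); rewrite reprK.
exists (\n_r), (\d_r); split; first exact: denom_ratioP.
suff E : \pi_{fraction D} r * (\d_r)%:F = (\n_r)%:F.
  by rewrite -E mulfK // tofrac_eq0 denom_ratioP.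
unlock FracField.tofrac.
rewrite -[LHS]FracField.pi_mul; apply/eqP.
rewrite FracField.equivf_def /FracField.mulf.
rewrite !numden_Ratio ?mulr1 ?oner_eq0 ?denom_ratioP //.
by rewrite mulrC.
Qed.

Section RationalFunctions.
Local Notation P := {poly rat}.
Local Notation K := {fraction P}.

(** The square makes [wt m.+1] exceed the weight allowed at index [k + (wt m).+1 * N] whenever [k]
    and [N] are at most [m]. *)
Fixpoint wt m :=
  if m is p.+1 then ((p + (wt p).+1 * p) ^ 2 + wt p).+1 else 1%N.

(** The default 1, used also for the zero polynomial, keeps products of denominators nonzero. *)
Definition denom p : P :=
  if unpickle p is Some b then if b == 0 then 1 else b else 1.

(* Once denominators are cleared, the exponents modulo [gap m] of an element of
   weight t < wt m.+1 are at most [slack m * t], less than half of [gap m]. *)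
Fixpoint slack m := if m is p.+1 then
  (slack p + size (denom p) + (2 * (slack p * wt p.+1)).+2)%N else 2%N.
Definition gap m := (2 * (slack m * wt m.+1)).+2.

(** Weights below [wt m.+1] leave room only for the inverses of nonzero [b] with [pickle b < m] and
    for the gap powers up to [gap m]. *)
Inductive wfil : nat -> K -> Prop :=
| wfil_const (a : rat) : wfil 0 (a%:P)%:F
| wfil_X : wfil 1 'X%:F
| wfil_gap m : wfil (wt m) ('X%:F ^+ gap m)
| wfil_inv b : wfil (wt (pickle b).+1) (b%:F)^-1
| wfil_add s f g : wfil s f -> wfil s g -> wfil s (f + g)
| wfil_mul s t f g : wfil s f -> wfil t g -> wfil (s + t) (f * g)
| wfil_le s t f : (s <= t)%N -> wfil s f -> wfil t f.

Lemma wt_gt0 m : (0 < wt m)%N. Proof. by case: m. Qed.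

Lemma wt_le : {homo wt : m n / (m <= n)%N}.
Proof.
apply: homo_leq => [//|y x z|m /=]; first exact: leq_trans.
by rewrite -addSn addnC leq_addr.
Qed.

Definition common_denom m : P := \prod_(p < m) denom p.

Lemma common_denom_neq0 m : common_denom m != 0.
Proof.
apply/prodf_neq0 => p _; rewrite /denom; case: unpickle => [b|].
  by case: ifP => [_|/negbT //]; exact: oner_neq0.
exact: oner_neq0.
Qed.

Lemma common_denom_size m : (size (common_denom m) < slack m)%N.
Proof.
elim: m => [|m IHm]; first by rewrite /common_denom big_ord0 size_poly1.
rewrite /common_denom big_ord_recr -/(common_denom m).
apply: leq_ltn_trans (size_polyMleq _ _) _.
have step a b s g : (a < s -> (a + b).-1 < s + b + g)%N by lia.
exact: step.
Qed.

(** The last summand in the recursion of [slack] is the preceding gap. *)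
Lemma gap_common_denom_size i m : (i < m)%N ->
  (gap i + size (common_denom m) <= slack m)%N.
Proof.
elim: m => [//|m IHm]; rewrite ltnS leq_eqVlt.
rewrite /common_denom big_ord_recr -/(common_denom m).
have step a b s g h : (a < s -> (h <= g \/ h + a <= s) ->
    h + (a + b).-1 <= s + b + g)%N by lia.
move=> ltim; apply: leq_trans (leq_add (leqnn _) (size_polyMleq _ _)) _.
apply: step (common_denom_size m) _.
by case/predU1P: ltim => [->|/IHm]; [left | right].
Qed.

Lemma dvd_common_denom m b : b != 0 -> (pickle b < m)%N ->
  exists q, common_denom m = b * q.
Proof.
move=> b0 lt_m; rewrite /common_denom (bigD1 (Ordinal lt_m)) //=.
by rewrite {1}/denom pickleK (negPf b0); eexists.
Qed.

Lemma size_common_denomX m t :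
  (size (common_denom m ^+ t)).-1 = ((size (common_denom m)).-1 * t)%N.
Proof. exact: size_exp. Qed.

Definition small_exponents m t (p : P) :=
  forall i, p`_i != 0 -> (i %% gap m <= slack m * t)%N.

Lemma small_exponents_size m t (p : P) :
  ((size p).-1 <= slack m * t)%N -> small_exponents m t p.
Proof.
move=> szp i pi0; apply: leq_trans (leq_mod _ _) _; apply: leq_trans szp.
have : (i < size p)%N by rewrite ltnNge; apply: contra pi0 => /leq_sizeP ->.
by case: (size p).
Qed.

Lemma small_exponentsM m s t (p q : P) : small_exponents m s p ->
  small_exponents m t q -> small_exponents m (s + t) (p * q).
Proof.
move=> Sp Sq i; rewrite coefM => pqi.
have [j _ pqj] : exists2 j : 'I_i.+1, true & p`_j * q`_(i - j) != 0.
  apply: contrapT => nj; case/eqP: pqi; apply: big1 => j _.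
  by apply: contrapT => /eqP pqj; apply: nj; exists j.
move: pqj; rewrite mulf_eq0 negb_or => /andP[/Sp lej /Sq lei].
rewrite -(@subnKC j i) ?leq_ord // -modnDm mulnDr.
by apply: leq_trans (leq_mod _ _) (leq_add _ _).
Qed.

Lemma small_exponents_denom m t : small_exponents m t (common_denom m ^+ t).
Proof.
apply: small_exponents_size; rewrite size_common_denomX leq_mul2r.
by have := common_denom_size m; lia.
Qed.

(** Induction on the generation of [f]: each inverse has weight at least 1, so [t] factors of the
    common denominator suffice. *)
Lemma wfil_exponents m t f : wfil t f -> (t < wt m.+1)%N ->
  exists2 p : P, f * (common_denom m ^+ t)%:F = p%:F & small_exponents m t p.
Proof.
have sizeP := common_denom_size m.
elim=> {t f} [a||k|b|s f g _ IHf _ IHg|s t f g _ IHf _ IHg|s t f le_st _ IHf]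
  lt_t.
- exists a%:P; first by rewrite expr0 mulr1.
  by apply: small_exponents_size; rewrite size_polyC; case: eqP.
- exists ('X * common_denom m); first by rewrite expr1 tofracM.
  apply: small_exponents_size; rewrite mulrC size_mulX ?common_denom_neq0 //=.
  by rewrite muln1 ltnW.
- exists ('X^(gap k) * common_denom m ^+ wt k).
    by rewrite tofracM -tofracXn.
  (* Multiplication by ['X^(gap m)] preserves residues; the smaller gaps fit into the slack by
     degree. *)
  have [->|ltkm] := eqVneq k m.
    move=> i; rewrite coefXnM; case: ltnP => [_|le_i]; first by rewrite eqxx.
    by move/small_exponents_denom; rewrite -{2}(subnK le_i) modnDr.
  have {ltkm}ltkm : (k < m)%N.
    rewrite ltn_neqAle ltkm leqNgt; apply: contraTN lt_t => ltmk.
    by rewrite -leqNgt wt_le.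
  apply: small_exponents_size.
  have P0 : common_denom m ^+ wt k != 0 by rewrite expf_neq0 ?common_denom_neq0.
  rewrite mulrC size_mulXn // -subn1 -addnBA; last by rewrite size_poly_gt0.
  rewrite subn1 size_common_denomX.
  have := gap_common_denom_size ltkm; have := wt_gt0 k; nia.
- have [->|b0] := eqVneq b 0.
    exists 0; first by rewrite tofrac0 invr0 mul0r.
    by move=> i; rewrite coef0 eqxx.
  have ltb : (pickle b < m)%N.
    by rewrite ltnNge; apply: contraTN lt_t => leb; rewrite -leqNgt wt_le.
  have [q Pq] := dvd_common_denom b0 ltb; set t := wt _.
  pose p := q * common_denom m ^+ t.-1.
  have PtE : common_denom m ^+ t = b * p.
    by rewrite mulrA -Pq -exprS prednK // wt_gt0.
  exists p; first by rewrite PtE tofracM mulKf ?tofrac_eq0.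
  apply: small_exponents_size.
  apply: (@leq_trans (size (common_denom m ^+ t)).-1).
    rewrite -!subn1 leq_sub2r // dvdp_leq ?expf_neq0 ?common_denom_neq0 //.
    by rewrite PtE dvdp_mulIr.
  by rewrite size_common_denomX leq_mul2r; lia.
- have [p fp Sp] := IHf lt_t; have [q gq Sq] := IHg lt_t.
  exists (p + q); first by rewrite mulrDl fp gq tofracD.
  move=> i; rewrite coefD; have [-> |/Sp //] := eqVneq p`_i 0.
  by rewrite add0r => /Sq.
- have [|p fp Sp] := IHf; first exact: leq_ltn_trans (leq_addr _ _) lt_t.
  have [|q gq Sq] := IHg; first exact: leq_ltn_trans (leq_addl _ _) lt_t.
  exists (p * q); last exact: small_exponentsM.
  by rewrite exprD !tofracM mulrACA fp gq.
have [|p fp Sp] := IHf; first exact: leq_ltn_trans lt_t.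
exists (p * common_denom m ^+ (t - s)).
  by rewrite -{1}(subnKC le_st) exprD !tofracM mulrA fp.
rewrite -(subnKC le_st); apply: small_exponentsM => //.
by rewrite subnKC //; exact: small_exponents_denom.
Qed.

(** Clearing denominators gives a polynomial of degree [e + d], where [d] is at most [slack m * t].
    The residue of this degree modulo [gap m] exceeds the slack and does not wrap around. *)
Lemma wfil_gap_exponent m t N : (0 < N)%N -> (t < wt m.+1)%N ->
  ~ wfil t ('X%:F ^+ (gap m * N.-1 + (slack m * wt m.+1).+1)).
Proof.
move=> N0 lt_t /wfil_exponents/(_ lt_t)[p].
rewrite -tofracXn -tofracM => /eqP; rewrite tofrac_eq => /eqP <-.
set e := (_ + _)%N; pose d := (size (common_denom m ^+ t)).-1.
have P0 : common_denom m ^+ t != 0 by rewrite expf_neq0 ?common_denom_neq0.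
have led : (d <= slack m * t)%N.
  rewrite /d size_common_denomX leq_mul2r.
  by have := common_denom_size m; lia.
have leD : (slack m * t <= slack m * wt m.+1)%N.
  by rewrite leq_mul2l ltnW ?orbT.
move/(_ (e + d)%N); rewrite coefXnM ltnNge leq_addr addKn.
rewrite -[_`_d]/(lead_coef _) lead_coef_eq0 => /(_ P0).
rewrite /e -addnA -modnDml modnMr add0n modn_small; first lia.
by rewrite /gap; lia.
Qed.

Fact wfil_opp s f : wfil s f -> wfil s (- f).
Proof.
rewrite -mulN1r -tofrac1 -tofracN -polyC1 -polyCN -[s]add0n => Gf.
by apply: wfil_mul => //; exact: wfil_const.
Qed.

Fact wfil_sub s f g : wfil s f -> wfil s g -> wfil s (f - g).
Proof. by move=> Gf Gg; apply: wfil_add => //; exact: wfil_opp. Qed.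

(** All generators other than constants have positive weight. *)
Fact wfil0_const f : wfil 0 f -> exists a : rat, f = (a%:P)%:F.
Proof.
move E: 0%N => t Gf; move: E => /esym.
elim: Gf => {t f}
  [a|//|m|b|s f g _ IHf _ IHg|s t f g _ IHf _ IHg|s t f le_st _ IHf].
- by exists a.
- by have := wt_gt0 m; case: wt.
- by have := wt_gt0 (pickle b).+1; case: wt.
- move=> s0; have [a ->] := IHf s0; have [b ->] := IHg s0.
  by exists (a + b); rewrite polyCD tofracD.
- case: s t IHf IHg => [|//] [|//] /(_ erefl)[a ->] /(_ erefl)[b ->] _.
  by exists (a * b); rewrite polyCM tofracM.
by move=> t0; apply: IHf; lia.
Qed.

Fact wfil0_inv f : wfil 0 f -> wfil 0 f^-1.
Proof.
move=> /wfil0_const[a ->]; suff -> : (a%:P)%:F^-1 = (a^-1%:P)%:F :> K.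
  exact: wfil_const.
have [->|a0] := eqVneq a 0; first by rewrite !(invr0, polyC0, tofrac0).
apply: (@mulfI _ (a%:P)%:F); first by rewrite tofrac_eq0 polyC_eq0.
by rewrite divff ?tofrac_eq0 ?polyC_eq0 // -tofracM -polyCM divff // tofrac1.
Qed.

Fact wfil_exhaustive f : exists s, wfil s f.
Proof.
have [p [b [_ ->]]] := tofrac_surj f.
have [s Gp] : exists s, wfil s p%:F.
  elim/poly_ind: p => [|p a [s Gp]]; first by exists 0%N; exact: wfil_const 0.
  exists (s + 1)%N; rewrite tofracD tofracM; apply: wfil_add.
    by apply: wfil_mul => //; exact: wfil_X.
  exact: wfil_le (leq0n _) (wfil_const a).
by exists (s + wt (pickle b).+1)%N; apply: wfil_mul => //; exact: wfil_inv.
Qed.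

Definition rat_filtration : filtration K :=
  @Filtration K wfil (wfil_const 1) wfil_sub wfil_mul wfil_le wfil0_inv
    wfil_exhaustive.

End RationalFunctions.

(** * Assembly of the counterexample *)

Theorem theorem1p1 :
  exists R : idomainType,
    [/\ krull_dim_eq R 1, local_ring R, sft_ring R, ~ sft_ring {poly R}
      & exists Q : set {poly R}, upper_to_zero Q /\ ~ sft_ideal Q].
Proof.
pose G := rat_filtration; pose u : {fraction {poly rat}} := 'X%:F.
have Q_upper := upper_upper_to_zero G u.
have Q_nsft : ~ sft_ideal (@upper _ G u).
  apply: upper_not_sft => [|k N N0]; first by rewrite tofrac_eq0 polyX_eq0.
  (* This [m] bounds both [k] and [N]. Since [gap m] is [2 * d + 2], the exponent below lies midway
     between two multiples of [gap m]. *)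
  pose m := (k + N)%N; pose d := (slack m * wt m.+1)%N.
  exists (wt m), (gap m), (gap m * N.-1 + d.+1)%N; split.
  - exact: wfil_gap.
  - rewrite leq_addr -[X in (_ < _ * X)%N](prednK N0) mulnS addnC ltn_add2r.
    by rewrite /gap; lia.
  apply: wfil_gap_exponent => //.
  by rewrite /= ltnS (leq_trans _ (leq_addr _ _)) // leq_exp2r //; nia.
exists (fil_ring G); split.
- exact: fil_krull_dim.
- exact: fil_local.
- exact: fil_sft.
- by move=> sft; apply: Q_nsft; apply: sft; have [[]] := Q_upper.
by exists (@upper _ G u).
Qed.
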